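(* Let $G$ be a finite graph and $\mathcal{VC}(G)$ the set of vertex covers of $G$. If $G$ is connected, then $T(\mathcal{VC}(G))$ is either the symmetric group or the alternating group on $\mathcal{VC}(G)$. If $G$ has components $G_1,G_2,\ldots,G_k$, then $T(\mathcal{VC}(G))\cong T(\mathcal{VC}(G_1))\times T(\mathcal{VC}(G_2))\times\cdots\times T(\mathcal{VC}(G_k))$.
   Context: A vertex cover of a graph $G$ is a subset of the vertices such that every edge of $G$ is incident to at least one vertex in the subset. $\mathcal{VC}(G)\subseteq 2^{V(G)}$, with ground set the vertex set $V(G)$. For a finite set $E$ and $\mathcal{L}\subseteq 2^E$, the toggle of $e\in E$ is the map $t_e:\mathcal{L}\to\mathcal{L}$ with $t_e(X)=X\cup\{e\}$ if $e\notin X$ and $X\cup\{e\}\in\mathcal{L}$; $t_e(X)=X\setminus\{e\}$ if $e\in X$ and $X\setminus\{e\}\in\mathcal{L}$; and $t_e(X)=X$ otherwise. The toggle group $T(\mathcal{L})$ is the subgroup of the symmetric group $\mathfrak{S}_{\mathcal{L}}$ generated by $\{t_e\mid e\in E\}$. *)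

(* Defs.v *)
From mathcomp Require Import all_boot all_fingroup all_solvable.

Set Implicit Arguments.
Unset Strict Implicit.
Unset Printing Implicit Defensive.

(* Loops are excluded: a looped vertex lies in every vertex cover, so it would
   disconnect the toggling of its neighbours without disconnecting the graph. *)
Record sgraph := SGraph {
  vertex :> finType;
  adj : rel vertex;
  adj_sym : symmetric adj;
  adj_irrefl : irreflexive adj
}.

(* The empty graph counts as connected. *)
Definition connected (G : sgraph) : Prop :=
  forall x y : G, connect (@adj G) x y.

Definition components (G : sgraph) : {set {set G}} :=
  equivalence_partition (connect (@adj G)) [set: G].

Section Induced.
Variables (G : sgraph) (S : {set G}).

Definition induced_adj : rel {x : G | x \in S} :=
  fun x y => adj (val x) (val y).

Lemma induced_adj_sym : symmetric induced_adj.
Proof. by move=> x y; apply: adj_sym. Qed.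

Lemma induced_adj_irrefl : irreflexive induced_adj.
Proof. by move=> x; apply: adj_irrefl. Qed.

Definition induced : sgraph := SGraph induced_adj_sym induced_adj_irrefl.
End Induced.

Definition vertex_covers (G : sgraph) : {set {set G}} :=
  [set X : {set G} |
    [forall x, forall y, adj x y ==> (x \in X) || (y \in X)]].

Section Toggle.
Variables (E : finType) (L : {set {set E}}).

Definition toggle_set (a : E) (X : {set E}) : {set E} :=
  if (a \notin X) && (a |: X \in L) then a |: X
  else if (a \in X) && (X :\ a \in L) then X :\ a
  else X.

Lemma toggle_set_in (a : E) (X : {set E}) : X \in L -> toggle_set a X \in L.
Proof.
by rewrite /toggle_set => XL; case: ifP => [/andP[]|_] //; case: ifP => [/andP[]|].
Qed.

Lemma toggle_set_invol (a : E) (X : {set E}) :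
  X \in L -> toggle_set a (toggle_set a X) = X.
Proof.
move=> XL; rewrite {2}/toggle_set; case: ifP => [/andP[aX aXL]|nadd].
  by rewrite /toggle_set setU11 /= setU1K // XL.
case: ifP => [/andP[aX XaL]|nrem].
  by rewrite /toggle_set setD11 /= setD1K // XL.
by rewrite /toggle_set nadd nrem.
Qed.

Definition toggle (a : E) (X : {X : {set E} | X \in L}) :
    {X : {set E} | X \in L} :=
  Sub (toggle_set a (val X)) (toggle_set_in a (valP X)).

Lemma toggle_inj (a : E) : injective (toggle a).
Proof.
apply: (can_inj (g := toggle a)) => X; apply: val_inj => /=.
exact: toggle_set_invol (valP X).
Qed.

Definition toggle_perm (a : E) : {perm {X : {set E} | X \in L}} :=
  perm (@toggle_inj a).

Definition toggle_group : {group {perm {X : {set E} | X \in L}}} :=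
  <<[set toggle_perm a | a : E]>>%G.
End Toggle.

(* Main.v *)
(* Write covers(S) for the set of vertex covers whose complement lies in S.  In
   the connected case, S is grown one vertex at a time from a single edge, and
   the toggles at the vertices of S are shown to induce every 3-cycle on
   covers(S).  To add v adjacent to some u in S, note that every cover in
   covers(S + v) but not in covers(S) misses v, hence is fixed by the toggle
   t_u.  So the commutator of t_u with an element inducing a suitable 3-cycle on
   covers(S) acts on covers(S + v) as exactly that 3-cycle.
   Conjugation by t_v gives all 3-cycles on t_v(covers(S)); the two sets overlap
   and their union is covers(S + v).  For S = V(G) the toggle group contains the
   alternating group.
   In the disconnected case a cover is a family of covers of the components, and
   a toggle acts on one coordinate only. *)
Require Import Defs.
From mathcomp Require Import all_boot all_fingroup all_solvable.

Set Implicit Arguments.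
Unset Strict Implicit.
Unset Printing Implicit Defensive.

Local Open Scope group_scope.

(** * Permutation groups containing all 3-cycles on a set *)

Section ThreeCycles.
Variable T : finType.
Implicit Types (x y z w a b f : T) (s : {perm T}) (A B : {set T}).
Implicit Types (R : {group {perm T}}).

(** Products act from left to right, so for distinct points [x] goes to [y], [y] to [z] and [z] to
    [x]. *)
Definition cycle3 x y z : {perm T} := tperm x y * tperm x z.

Lemma uniq3 x y z : uniq [:: x; y; z] = [&& x != y, x != z & y != z].
Proof. by rewrite /= !inE negb_or andbT andbA. Qed.

Lemma cycle3J x y z s : cycle3 x y z ^ s = cycle3 (s x) (s y) (s z).
Proof. by rewrite conjMg !tpermJ. Qed.

Lemma cycle3V x y z : (cycle3 x y z)^-1 = cycle3 x z y.
Proof. by rewrite invMg !tpermV. Qed.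

Lemma cycle3_rot x y z : uniq [:: x; y; z] -> cycle3 x y z = cycle3 y z x.
Proof.
rewrite uniq3 => /and3P[xy xz yz].
rewrite /cycle3 (tpermC y x) -(tpermJ_tperm xz yz) conjgE tpermV.
by rewrite -!mulgA tperm2 mulg1.
Qed.

Lemma cycle3E1 x y z : uniq [:: x; y; z] -> cycle3 x y z x = y.
Proof.
rewrite uniq3 => /and3P[xy xz yz].
by rewrite permM tpermL tpermD // eq_sym.
Qed.

Lemma cycle3E2 x y z : cycle3 x y z y = z.
Proof. by rewrite permM tpermR tpermL. Qed.

Lemma cycle3E3 x y z : uniq [:: x; y; z] -> cycle3 x y z z = x.
Proof.
rewrite uniq3 => /and3P[xy xz yz].
by rewrite permM (tpermD xz yz) tpermR.
Qed.

Lemma cycle3_out x y z w : w \notin [:: x; y; z] -> cycle3 x y z w = w.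
Proof.
by rewrite !inE !negb_or => /and3P[wx wy wz]; rewrite permM !tpermD // eq_sym.
Qed.

Lemma cycle3_sqr x y z :
  uniq [:: x; y; z] -> cycle3 x y z * cycle3 x y z = cycle3 x z y.
Proof.
move=> u; have u1 : uniq [:: z; x; y] by rewrite -(rot_uniq 1).
rewrite -{2}(cycle3_rot u1) {1 2}/cycle3 (tpermC z x) -mulgA.
rewrite (mulgA (tperm x z)) tperm2 mul1g tpermC (tpermC z) -/(cycle3 y x z).
rewrite cycle3_rot //.
by move: u; rewrite !uniq3 (eq_sym x) => /and3P[-> -> ->].
Qed.

Lemma cycle3_on A x y z :
  x \in A -> y \in A -> z \in A -> perm_on A (cycle3 x y z).
Proof.
move=> xA yA zA; apply/subsetP=> w /=; apply: contraR => wA.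
apply/eqP/cycle3_out.
by apply: contra wA; rewrite !inE => /or3P[]/eqP->.
Qed.

Definition has_cycles3 R A := forall x y z,
  x \in A -> y \in A -> z \in A -> uniq [:: x; y; z] -> cycle3 x y z \in R.

Lemma has_cycles3J R A s :
  has_cycles3 R A -> s \in R -> has_cycles3 R (s @: A).
Proof.
move=> RA sR _ _ _ /imsetP[x xA ->] /imsetP[y yA ->] /imsetP[z zA ->].
move=> u; rewrite -cycle3J groupJ // RA //.
by rewrite -(map_inj_uniq (@perm_inj _ s)).
Qed.

Lemma third_elt A x y : 2 < #|A| -> exists2 z, z \in A & z \notin [:: x; y].
Proof.
move=> A2; have [z zA|] := pickP [pred z in A | z \notin [:: x; y]].
  by case/andP: zA; exists z.
move=> A0; suff: #|A| <= 2 by rewrite leqNgt A2.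
apply: leq_trans (card_size [:: x; y]); apply/subset_leq_card/subsetP=> z zA.
by have:= A0 z; rewrite /= zA /= => /negbFE.
Qed.

(** When [a], [b], [c] all differ from [x], conjugating [(x a c)] by [(x c b)] gives [(c a b)],
    which is [(a b c)]. *)
Lemma has_cycles3_base R A x : x \in A ->
  (forall y z, y \in A -> z \in A -> uniq [:: x; y; z] -> cycle3 x y z \in R) ->
  has_cycles3 R A.
Proof.
move=> xA Rx a b c aA bA cA abc.
have [xa|xa] := eqVneq x a; first by subst a; apply: Rx.
have [xb|xb] := eqVneq x b.
  by subst b; rewrite cycle3_rot // Rx // (rot_uniq 1 [:: a; x; c]) .
have [xc|xc] := eqVneq x c.
  by subst c; rewrite -cycle3_rot ?Rx // -(rot_uniq 1 [:: x; a; b]).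
have := abc; rewrite uniq3 => /and3P[ab ac bc].
have u1 : uniq [:: x; a; c] by rewrite uniq3 xa xc ac.
have u2 : uniq [:: x; c; b] by rewrite uniq3 xb xc eq_sym bc.
have := groupJ (Rx _ _ aA cA u1) (Rx _ _ cA bA u2).
rewrite cycle3J cycle3E1 // cycle3E2 // cycle3_out.
  by rewrite cycle3_rot ?(rot_uniq 2 [:: a; b; c]).
by rewrite !inE !negb_or eq_sym xa ab ac.
Qed.

(** By [has_cycles3_base] only cycles through the common point [x] matter. Up to inversion, the new
    ones are [(x y z)] with [y] in [A] and [z] in [B]; third elements of [A] and [B] provide cycles
    to conjugate with. *)
Lemma has_cycles3U R A B x : has_cycles3 R A -> has_cycles3 R B ->
  x \in A -> x \in B -> 2 < #|A| -> 2 < #|B| -> has_cycles3 R (A :|: B).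
Proof.
move=> RA RB xA xB A2 B2.
suff mixed y z : y \in A -> z \in B -> uniq [:: x; y; z] -> cycle3 x y z \in R.
  apply: (@has_cycles3_base _ _ x) => [|y z]; first by rewrite inE xA.
  rewrite !inE => /orP[]yU /orP[]zU u; try by [exact: RA | exact: RB | exact: mixed].
  rewrite -cycle3V groupV; apply: mixed => //.
  by move: u; rewrite !uniq3 (eq_sym y) andbCA.
move=> yA zB u; have [zA|zA] := boolP (z \in A); first exact: RA.
have [yB|yB] := boolP (y \in B); first exact: RB.
have := u; rewrite uniq3 => /and3P[xy xz yz].
have [y' y'A] := third_elt x y A2; rewrite !inE negb_or => /andP[y'x y'y].
have y'z : y' != z by apply: contraNneq zA => <-.
have uA : uniq [:: x; y; y'].
  by rewrite uniq3 xy (eq_sym x) y'x (eq_sym y) y'y.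
(* If [y'] is shared, [(x y y')] conjugated by [(x z y')] is [(z y x)], the inverse of [(x y z)]. *)
have [y'B|y'B] := boolP (y' \in B).
  have uB : uniq [:: x; z; y'].
    by rewrite uniq3 xz (eq_sym x) y'x (eq_sym z) y'z.
  have := groupJ (RA _ _ _ xA yA y'A uA) (RB _ _ _ xB zB y'B uB).
  rewrite cycle3J cycle3E1 // cycle3E3 // cycle3_out => [|]; last first.
    by rewrite !inE !negb_or eq_sym xy yz eq_sym.
  by rewrite -groupV cycle3V cycle3_rot // -(rot_uniq 1).
(* Otherwise [(x z z')] sends [x] to [z] and fixes [y] and [y'], so it conjugates [(x y y')] to
   [(z y y')]; conjugating by the inverse of [(x y y')] then gives [(z x y)]. *)
have [z' z'B] := third_elt x z B2; rewrite !inE negb_or => /andP[z'x z'z].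
have z'y : z' != y by apply: contraNneq yB => <-.
have z'y' : z' != y' by apply: contraNneq y'B => <-.
have uB : uniq [:: x; z; z'].
  by rewrite uniq3 xz (eq_sym x) z'x (eq_sym z) z'z.
have cA := RA _ _ _ xA yA y'A uA.
have := groupJ (groupJ cA (RB _ _ _ xB zB z'B uB)) (groupVr cA).
rewrite !cycle3J cycle3V cycle3E1 // (cycle3_out (w := y)); last first.
  by rewrite !inE !negb_or eq_sym xy yz eq_sym.
rewrite (cycle3_out (w := y')) ?inE ?negb_or ?y'x ?y'z 1?eq_sym //.
have uA' : uniq [:: x; y'; y].
  by rewrite uniq3 xy (eq_sym x) y'x y'y.
rewrite (cycle3_out (w := z)) ?cycle3E2 ?cycle3E3 //.
  by rewrite cycle3_rot // -(rot_uniq 1).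
by rewrite !inE !negb_or eq_sym xz (eq_sym z y') y'z eq_sym.
Qed.

(* If h acts on A as c = (a b f), then t ^ h = t ^ c because t is supported on
   A; since t inverts c, the commutator of h and t is c^-2 = c. *)
Lemma has_cycles3_lift R A t a b f :
  (forall x y z, x \in A -> y \in A -> z \in A -> uniq [:: x; y; z] ->
     exists2 h, h \in R & {in A, h =1 cycle3 x y z}) ->
  t \in R -> perm_on A t -> a \in A -> b \in A -> f \in A ->
  uniq [:: a; b; f] -> t a = b -> t b = a -> t f = f -> has_cycles3 R A.
Proof.
move=> lift tR tA aA bA fA u ta tb tf.
have conj_on (s h c : {perm T}) :
    perm_on A s -> perm_on A c -> {in A, h =1 c} -> s ^ h = s ^ c.
  move=> sA cA hc; have hcV : perm_on (~: A) (h * c^-1).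
    apply/subsetP=> w; apply: contraR; rewrite inE negbK => wA.
    by rewrite permM hc // permK.
  have dA : [disjoint ~: A & A] by rewrite -setI_eq0 setIC setICr.
  have com := perm_onC hcV sA dA.
  rewrite -[h](mulgKV c) conjgM; congr (_ ^ _).
  by rewrite conjgE -com mulKg.
have abfR : cycle3 a b f \in R.
  have [h hR hc] := lift _ _ _ aA bA fA u.
  have := groupM (groupVr (groupJ tR hR)) tR.
  rewrite (conj_on _ _ _ tA (cycle3_on aA bA fA) hc).
  have -> (c : {perm T}) : (t ^ c)^-1 * t = c^-1 * c ^ t.
    by rewrite !conjgE !invMg invgK !mulgA.
  rewrite cycle3J ta tb tf (@cycle3_rot b); last first.
    by move: u; rewrite !uniq3 eq_sym => /and3P[-> -> ->].
  rewrite cycle3V cycle3_sqr //.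
  by move: u; rewrite !uniq3 (eq_sym b); case/and3P=> -> -> ->.
(* Conjugating a permutation supported on [a], [y], [z] uses only the values of [h] at these points,
   so [h] may be arbitrary off [A]. Starting from [(a b f)], this move reaches [(a f w)], then
   [(a w w')], hence all cycles through [a]. *)
have step y z w : y \in A -> z \in A -> w \in A -> uniq [:: a; y; z] ->
    uniq [:: y; z; w] -> cycle3 a y z \in R -> a != w -> cycle3 a z w \in R.
  move=> yA zA wA u1 u2 ayz aw; have [h hR hc] := lift _ _ _ yA zA wA u2.
  have := groupJ ayz hR; rewrite cycle3J !hc // cycle3E1 // cycle3E2 cycle3_out //.
  by rewrite !inE !negb_or aw andbT; move: u1; rewrite uniq3 => /and3P[-> ->].
have inv y z : cycle3 a y z \in R -> cycle3 a z y \in R.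
  by rewrite -cycle3V groupV.
have := u; rewrite uniq3 => /and3P[ab af bf].
apply: (has_cycles3_base aA) => y z yA zA; rewrite uniq3 => /and3P[ay az yz].
have [yb|yb] := eqVneq y b.
  have [zf|zf] := eqVneq z f; first by rewrite yb zf.
  subst y; apply: (@step f) => //; last exact: inv.
    by rewrite uniq3 af ab eq_sym.
  by rewrite uniq3 eq_sym bf eq_sym zf.
have fR w : w \in A -> a != w -> w != b -> w != f -> cycle3 a f w \in R.
  by move=> wA aw wb wf; apply: (@step b); rewrite // uniq3 bf !(eq_sym _ w) wb.
have [yf|yf] := eqVneq y f.
  have [zb|zb] := eqVneq z b; first by rewrite yf zb inv.
  by subst y; apply: fR => //; rewrite eq_sym.
have [zf|zf] := eqVneq z f; first by rewrite zf inv ?fR.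
by apply: (@step f); rewrite ?fR // uniq3 ?af ?ay ?yz ?(eq_sym f) ?yf ?zf.
Qed.

(** An even permutation is a product of pairs of transpositions. Two that share a point cancel or
    form a 3-cycle; for others, insert [(a c)(a c)] between [(a b)] and [(c d)]. *)
Lemma Alt_sub_cycles3 R : has_cycles3 R [set: T] -> 'Alt_T \subset R.
Proof.
move=> R3; have fork a b c : a != b -> a != c -> tperm a b * tperm a c \in R.
  move=> ab ac; have [<-|bc] := eqVneq b c; first by rewrite tperm2.
  by apply: R3; rewrite ?inE // uniq3 ab ac.
have pair a b c d : a != b -> c != d -> tperm a b * tperm c d \in R.
  move=> ab cd; have [ac|ac] := eqVneq a c.
    by rewrite -ac in cd *; apply: fork.
  rewrite -[tperm a b](mulgK (tperm a c)) tpermV -mulgA groupM ?fork //.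
  by rewrite tpermC fork // eq_sym.
apply/subsetP=> s; rewrite Alt_even; have [ts -> ts_d] := prod_tpermP s.
rewrite odd_perm_prod //; have [n] := ubnP (size ts).
elim: n => // n IHn in ts ts_d *; case: ts ts_d => [|t1 [|t2 ts]] //=.
  by rewrite big_nil.
case/and3P=> d1 d2 ts_d lt_n; rewrite negbK => ev.
by rewrite !big_cons mulgA groupM ?pair // IHn // ltnW.
Qed.

(** Once [R] has an odd element [s], any odd [p] is the even [p * s^-1] times [s]. *)
Lemma Alt_sub_eq (R : {group {perm T}}) :
  'Alt_T \subset R -> R = 'Sym_T :> {set _} \/ R = 'Alt_T :> {set _}.
Proof.
move=> AR; have [RA|/subsetPn[s sR]] := boolP (R \subset 'Alt_T).
  by right; apply/eqP; rewrite eqEsubset RA.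
rewrite Alt_even negbK => s_odd; left; apply/setP=> p; rewrite in_setT.
have [p_odd|p_even] := boolP (odd_perm p); last first.
  by rewrite (subsetP AR) ?Alt_even.
rewrite -[p](mulgKV s) groupM // (subsetP AR) // Alt_even odd_permM odd_permV.
by rewrite p_odd s_odd.
Qed.
End ThreeCycles.

(** * Toggles acting on the vertex covers of a graph *)

Section CoverToggles.
Variable G : sgraph.
Local Notation cover := {X : {set G} | X \in vertex_covers G}.
Implicit Types (a b u v w z : G) (X Y : cover) (S : {set G}).

Lemma cover_adj X a b : adj a b -> (a \in val X) || (b \in val X).
Proof.
case: X => X /=; rewrite inE => /forallP/(_ a)/forallP/(_ b)/implyP.
exact.
Qed.

Lemma toggle_permE a X : toggle_perm (vertex_covers G) a X = toggle a X.
Proof. exact: permE. Qed.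

(** Supersets of covers are covers, so only a removal can be blocked. *)
Lemma toggle_add X a : a \notin val X -> val (toggle a X) = a |: val X.
Proof.
move=> aX; rewrite /= /toggle_set aX; case: ifPn => //= /negP[].
rewrite inE; apply/forallP=> x; apply/forallP=> y; apply/implyP=> xy.
by rewrite !inE; have /orP[] := cover_adj X xy => ->; rewrite !orbT.
Qed.

Lemma toggle_blocked X a b : adj a b -> b \notin val X -> toggle a X = X.
Proof.
move=> ab bX; have := cover_adj X ab; rewrite (negPf bX) orbF => aX.
apply: val_inj; rewrite /= /toggle_set aX /=; case: ifPn => //.
rewrite inE => /forallP/(_ a)/forallP/(_ b)/implyP/(_ ab).
by rewrite !inE eqxx (negPf bX) andbF.
Qed.

Lemma toggleK a : involutive (@toggle _ (vertex_covers G) a).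
Proof. by move=> X; apply: val_inj; exact: toggle_set_invol (valP X). Qed.

Lemma toggle_out X a b : b != a -> (b \in val (toggle a X)) = (b \in val X).
Proof.
move=> ba; rewrite /= /toggle_set.
by case: ifP => // _; [|case: ifP => //]; rewrite !inE (negPf ba).
Qed.

Lemma setT_cover : [set: G] \in vertex_covers G.
Proof. by rewrite inE; do 2!apply/forallP=> ?; rewrite !inE implybT. Qed.

Lemma setC1_cover u : [set~ u] \in vertex_covers G.
Proof.
rewrite inE; apply/forallP=> x; apply/forallP=> y; apply/implyP=> xy.
rewrite !inE -negb_and; apply: contraTN xy => /andP[/eqP-> /eqP->].
by rewrite adj_irrefl.
Qed.

Definition coverT : cover := Sub [set: G] setT_cover.
Definition coverC1 u : cover := Sub [set~ u] (setC1_cover u).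

Lemma toggle_coverC1 u : toggle u (coverC1 u) = coverT.
Proof.
by apply: val_inj; rewrite toggle_add ?setC11 //= setUCr.
Qed.

Lemma toggle_coverT u : toggle u coverT = coverC1 u.
Proof. by rewrite -(toggle_coverC1 u) toggleK. Qed.

Lemma coverC1_neqT u : coverC1 u != coverT.
Proof. by rewrite -val_eqE; apply/eqP=> /= /setP/(_ u); rewrite !inE eqxx. Qed.

Lemma coverC1_inj : injective coverC1.
Proof. by move=> u z /(congr1 val)/setC_inj/set1_inj. Qed.

(** Complements of covers are independent sets, so these model the covers of the subgraph induced on
    [S] while staying in the type of covers of [G]. *)
Definition covers_off S : {set cover} := [set X | ~: val X \subset S].

Definition toggles_of S : {group {perm cover}} :=
  <<[set toggle_perm (vertex_covers G) a | a in S]>>%G.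

Lemma mem_covers_off S X a : X \in covers_off S -> a \notin val X -> a \in S.
Proof. by rewrite inE => /subsetP XS aX; apply: XS; rewrite inE. Qed.

Lemma coverT_off S : coverT \in covers_off S.
Proof. by rewrite inE setCT sub0set. Qed.

Lemma coverC1_off S u : u \in S -> coverC1 u \in covers_off S.
Proof. by rewrite inE setCK sub1set. Qed.

Lemma toggle_off S X a :
  a \in S -> (toggle a X \in covers_off S) = (X \in covers_off S).
Proof.
move=> aS; rewrite !inE; apply/subsetP/subsetP=> XS b; rewrite inE.
  have [->//|ba] := eqVneq b a.
  by rewrite -(toggle_out _ ba) => bX; apply: XS; rewrite inE.
have [->//|ba] := eqVneq b a.
by rewrite (toggle_out _ ba) => bX; apply: XS; rewrite inE.
Qed.

Lemma toggles_of_norm S : toggles_of S \subset 'N(covers_off S | 'P).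
Proof.
rewrite gen_subG; apply/subsetP=> _ /imsetP[a aS ->].
by rewrite !inE; apply/subsetP=> X XS; rewrite inE /= apermE permE toggle_off.
Qed.

(** The action on [covers_off S], extended by the identity elsewhere, so that the groups for all [S]
    consist of permutations of one type. *)
Definition restr_toggles S : {group {perm cover}} :=
  (restr_perm (covers_off S) @* toggles_of S)%G.

Lemma restr_togglesP S c :
  reflect (exists2 h, h \in toggles_of S & c = restr_perm (covers_off S) h)
          (c \in restr_toggles S).
Proof.
apply: (iffP morphimP) => [[h _ hS ->]|[h hS ->]]; first by exists h.
by exists h => //; apply: (subsetP (toggles_of_norm S)).
Qed.

Lemma restr_toggleE S h X :
  h \in toggles_of S -> X \in covers_off S -> restr_perm (covers_off S) h X = h X.
Proof. by move=> hS; apply: restr_permE; apply: (subsetP (toggles_of_norm S)). Qed.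

Lemma mem_toggles S a : a \in S -> toggle_perm _ a \in toggles_of S.
Proof. by move=> aS; apply/mem_gen/imset_f. Qed.

Lemma mem_restr_toggles S h c : h \in toggles_of S ->
  perm_on (covers_off S) c -> {in covers_off S, h =1 c} -> c \in restr_toggles S.
Proof.
move=> hS cS hc; apply/restr_togglesP; exists h => //; apply/permP=> X.
have [XS|XS] := boolP (X \in covers_off S); first by rewrite restr_toggleE ?hc.
by rewrite (out_perm cS XS) (out_perm (restr_perm_on _ _) XS).
Qed.

Lemma three_covers S u z : u \in S -> z \in S -> u != z ->
  uniq [:: coverT; coverC1 u; coverC1 z] /\ 2 < #|covers_off S|.
Proof.
move=> uS zS uz.
have Uq : uniq [:: coverT; coverC1 u; coverC1 z].
  by rewrite uniq3 !(eq_sym coverT) !coverC1_neqT (inj_eq coverC1_inj).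
split=> //; rewrite -[3]/(size [:: coverT; coverC1 u; coverC1 z]) cardE.
apply: uniq_leq_size => // X; rewrite mem_enum !in_cons in_nil orbF.
by case/or3P=> /eqP->; rewrite ?coverT_off ?coverC1_off.
Qed.

Lemma adj_neq u v : adj u v -> u != v.
Proof. by apply: contraTneq => ->; rewrite adj_irrefl. Qed.

Lemma toggle_coverC1_adj u v : adj u v -> toggle u (coverC1 v) = coverC1 v.
Proof. by move=> uv; apply: (toggle_blocked uv); rewrite setC11. Qed.

(** * Growing the vertex set in a connected graph *)

Definition full_on S := has_cycles3 (restr_toggles S) (covers_off S).

(** No cover misses both ends of an edge, so just three covers remain. Each of the two toggles swaps
    the full cover with one of the others and fixes the third, so their product is a 3-cycle; it and
    its inverse are all that is required. *)
Lemma full_on_edge u z : adj u z -> full_on [set u; z].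
Proof.
move=> uz; have uz' := adj_neq uz; set S := [set u; z].
have [uS zS] : u \in S /\ z \in S by rewrite !inE !eqxx orbT.
have zu : adj z u by rewrite adj_sym.
have [Uq _] := three_covers uS zS uz'.
have SE X : X \in covers_off S -> X \in [:: coverT; coverC1 u; coverC1 z].
  move=> XS.
  have sub1 a b : b \in val X -> S = [set b; a] -> X = coverC1 a \/ X = coverT.
    move=> bX Sab; have: ~: val X \subset [set a].
      apply/subsetP=> c; rewrite in_setC => cX; have := mem_covers_off XS cX.
      by rewrite Sab => /setUP[/set1P cb|//]; rewrite cb bX in cX.
    rewrite subset1 => /orP[]/eqP Xa; [left|right]; apply/val_inj/setC_inj => /=.
      by rewrite Xa setCK.
    by rewrite Xa setCT.
  rewrite !inE; case/orP: (cover_adj X uz) => inX.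
    by case: (sub1 z u inX erefl) => ->; rewrite eqxx ?orbT.
  by case: (sub1 u z inX (setUC _ _)) => ->; rewrite eqxx ?orbT.
suff cR : cycle3 coverT (coverC1 u) (coverC1 z) \in restr_toggles S.
  have cR' := groupVr cR; rewrite cycle3V in cR'.
  apply: (has_cycles3_base (coverT_off S)) => Y Z /SE + /SE; rewrite !inE.
  do 2![case/or3P=> /eqP->]; rewrite ?cR ?cR' // uniq3 ?eqxx ?andbF //.
apply: (@mem_restr_toggles _ (toggle_perm _ u * toggle_perm _ z)).
- by rewrite groupM ?mem_toggles.
- by rewrite cycle3_on ?coverT_off ?coverC1_off.
move=> X /SE; rewrite !inE (permM (toggle_perm _ u)) !toggle_permE => /or3P[]/eqP->.
- by rewrite cycle3E1 // toggle_coverT toggle_coverC1_adj.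
- by rewrite cycle3E2 // toggle_coverC1 toggle_coverT.
by rewrite cycle3E3 // toggle_coverC1_adj // toggle_coverC1.
Qed.

Lemma full_on_add S u v z : u \in S -> z \in S -> v \notin S ->
  adj u z -> adj u v -> full_on S -> full_on (v |: S).
Proof.
move=> uS zS vS uz uv fullS; set S' := v |: S; set I := covers_off S'.
set A := covers_off S; have uz' := adj_neq uz.
have SS' : S \subset S' by apply: subsetUr.
have vS' : v \in S' by apply: setU11.
have AI : A \subset I.
  by apply/subsetP=> X; rewrite !inE => /subset_trans; apply.
have HH : toggles_of S \subset toggles_of S' by rewrite genS ?imsetS.
have [Uq A2] := three_covers uS zS uz'.
have inA X : X \in I -> v \in val X -> X \in A.
  move=> XI vX; rewrite inE; apply/subsetP=> a; rewrite inE => aX.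
  by have := mem_covers_off XI aX; rewrite !inE; case: eqP aX => // ->; rewrite vX.
pose t a := restr_perm I (toggle_perm (vertex_covers G) a).
have tR a : a \in S' -> t a \in restr_toggles S'.
  by move=> aS; apply/restr_togglesP; exists (toggle_perm _ a); rewrite ?mem_toggles.
have tE a X : a \in S' -> X \in I -> t a X = toggle a X.
  by move=> aS XI; rewrite restr_toggleE ?mem_toggles // permE.
have [TA uA zA] : [/\ coverT \in A, coverC1 u \in A & coverC1 z \in A].
  by rewrite coverT_off !coverC1_off.
have uS' := subsetP SS' u uS.
have fullA : has_cycles3 (restr_toggles S') A.
  (* [t u] swaps [coverT] and [coverC1 u], and fixes [coverC1 z] because [z] is adjacent to [u]. *)
  apply: (@has_cycles3_lift _ _ _ (t u) coverT (coverC1 u) (coverC1 z)) => //.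
  - move=> X Y Z XA YA ZA U.
    have /restr_togglesP[h hS hE] := fullS _ _ _ XA YA ZA U.
    exists (restr_perm I h).
      by apply/restr_togglesP; exists h; rewrite // (subsetP HH).
    move=> W WA; rewrite restr_toggleE ?(subsetP HH) ?(subsetP AI) //.
    by rewrite hE restr_toggleE.
  - exact: tR.
  - apply/subsetP=> X; apply: contraR => XA; have [XI|XI] := boolP (X \in I).
      rewrite tE // (toggle_blocked uv) //.
      by apply: contra XA; apply: inA.
    by rewrite (out_perm (restr_perm_on _ _) XI).
  - by rewrite tE ?toggle_coverT // (subsetP AI).
  - by rewrite tE ?toggle_coverC1 // (subsetP AI).
  by rewrite tE ?toggle_coverC1_adj // (subsetP AI).
have fullB := has_cycles3J fullA (tR v vS').
(* The common point of the two sets: [t v] fixes [coverC1 u], since [u] is adjacent to [v]. *)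
have uB : coverC1 u \in t v @: A.
  apply/imsetP; exists (coverC1 u) => //.
  by rewrite tE ?toggle_coverC1_adj // 1?adj_sym // (subsetP AI).
(* A cover missing [v] is the [t v]-image of the cover obtained by adding [v], which lies in [A]. *)
have AB : I \subset A :|: t v @: A.
  apply/subsetP=> X XI; rewrite inE; have [vX|vX] := boolP (v \in val X).
    by rewrite inA.
  apply/orP; right; apply/imsetP; exists (toggle v X).
    by rewrite inA ?toggle_off // toggle_add // setU11.
  by rewrite tE ?toggleK // toggle_off.
have := has_cycles3U fullA fullB uA uB A2; rewrite card_imset; last exact: perm_inj.
move=> /(_ A2) fullU X Y Z XI YI ZI; apply: fullU; exact: (subsetP AB).
Qed.

Lemma full_on_setT u z : connected G -> adj u z -> full_on [set: G].
Proof.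
move=> conG uz.
(* The second clause supplies the neighbour [z] inside [S] that [full_on_add] asks for. *)
pose inv S := [/\ S != set0, forall a, a \in S -> exists2 b, b \in S & adj a b
                 & full_on S].
suff grow n S : #|~: S| <= n -> inv S -> full_on [set: G].
  apply: (grow _ _ (leqnn _)); split; last exact: full_on_edge uz.
    by apply/set0Pn; exists u; rewrite !inE eqxx.
  by move=> a; rewrite !inE => /orP[]/eqP->; [exists z|exists u];
    rewrite ?inE ?eqxx ?orbT // adj_sym.
elim: n S => [|n IHn] S.
  rewrite leqn0 cards_eq0 => /eqP S0 [_ _].
  by rewrite -(setCK S) S0 setC0.
move=> Sn [S0 Snb Sfull].
(* A nonempty set closed under adjacency is everything, by connectedness; otherwise an edge leaves
   [S] and its outer end is added. *)
have [clS|] := boolP [forall a in S, forall b, adj a b ==> (b \in S)].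
  suff <- : S = setT by [].
  case/set0Pn: S0 => x xS; apply/setP=> y; rewrite inE.
  have clo : closed (@adj G) S.
    apply: (intro_closed (sym_connect_sym (@adj_sym G))) => a b ab aS.
    by have /forall_inP/(_ a aS)/forallP/(_ b)/implyP/(_ ab) := clS.
  by rewrite -(closed_connect clo (conG x y)).
rewrite negb_forall_in => /exists_inP[a aS].
rewrite negb_forall => /existsP[v]; rewrite negb_imply => /andP[av vS].
have [b bS ab] := Snb a aS.
apply: (IHn (v |: S)).
  rewrite -ltnS; apply: leq_trans Sn; apply: proper_card.
  rewrite properC; apply/properP; split; first exact: subsetUr.
  by exists v; rewrite ?setU11.
split; first by apply/set0Pn; exists v; rewrite setU11.
  move=> c; rewrite !inE => /orP[/eqP->|cS].
    by exists a; rewrite 1?adj_sym // !inE aS orbT.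
  by have [d dS cd] := Snb c cS; exists d; rewrite // !inE dS orbT.
exact: (full_on_add aS bS vS ab av Sfull).
Qed.

Lemma connected_toggle_group : connected G ->
  'Alt_cover \subset toggle_group (vertex_covers G).
Proof.
move=> conG; have [|noadj] := pickP (fun e : G * G => adj e.1 e.2).
  case=> u z /= uz; apply: Alt_sub_cycles3 => X Y Z _ _ _ U.
  have offT W : W \in covers_off setT by rewrite inE subsetT.
  have /restr_togglesP[h hT hE] :=
    full_on_setT conG uz (offT X) (offT Y) (offT Z) U.
  have -> : cycle3 X Y Z = h by apply/permP=> W; rewrite hE restr_toggleE.
  by apply: subsetP hT; rewrite genS //; apply: imsetS; apply/subsetP.
(* A connected graph without edges has at most one vertex, hence at most two covers, and the
   alternating group is trivial. *)
rewrite trivial_Alt_2 ?sub1G // card_sig.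
have G1 : #|G| <= 1.
  apply/fintype_le1P=> x y; have /connectP[[|w p] /=] := conG x y.
    by move=> _ ->.
  by case/andP=> xw; have := noadj (x, w); rewrite /= xw.
apply: (@leq_trans #|{set G}|); first exact: max_card.
by rewrite -cardsT -powersetT card_powerset cardsT (@leq_exp2l 2 _ 1).
Qed.
End CoverToggles.

(** Makes toggling local: the outcome depends only on [a] and its neighbours, so it can be compared
    between [G] and a component. *)
Lemma toggle_in (G : sgraph) (X : {X : {set G} | X \in vertex_covers G}) a :
  (a \in val (toggle a X)) =
  (a \notin val X) || [exists b, adj a b && (b \notin val X)].
Proof.
have [aX|aX] := boolP (a \in val X); last by rewrite (toggle_add aX) setU11.
have [/existsP[b /andP[ab bX]]|] := boolP [exists b, adj a b && (b \notin val X)].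
  by rewrite (toggle_blocked ab bX) aX.
rewrite negb_exists => /forallP nb; rewrite /= /toggle_set aX /=.
case: ifPn => [_|/negP[]]; first by rewrite !inE eqxx.
have nbX b : adj a b -> b \in val X by move=> ab; have := nb b; rewrite ab negbK.
rewrite inE; apply/forallP=> x; apply/forallP=> y; apply/implyP=> xy.
have /orP[xX|yX] := cover_adj X xy; rewrite !inE.
  have [xa|xa] := eqVneq x a; last by rewrite xX.
  rewrite -xa in nbX; rewrite (nbX _ xy) andbT /= -xa.
  by apply: contraTneq xy => ->; rewrite adj_irrefl.
rewrite yX; have [ya|ya] := eqVneq y a; last by rewrite orbT.
rewrite -ya in nbX; rewrite orbF (nbX x) 1?adj_sym // andbT -ya.
by apply: contraTneq xy => ->; rewrite adj_irrefl.
Qed.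

(** * Decomposition along connected components *)

Section Components.
Variables (G : sgraph) (k : nat) (C : 'I_k -> {set G}).
Hypothesis C_inj : injective C.
Hypothesis C_comp : [set C i | i : 'I_k] = components G.

Local Notation cover H := {X : {set vertex H} | X \in vertex_covers H}.
Local Notation Gi i := (induced (C i)).

Lemma components_part : partition (components G) [set: G].
Proof.
apply: equivalence_partitionP => x y z _ _ _.
split=> [|xy]; first exact: connect0.
exact: (same_connect (sym_connect_sym (@adj_sym G)) xy).
Qed.

Lemma comp_cover x : exists i, x \in C i.
Proof.
have /and3P[/eqP covG _ _] := components_part.
have : x \in finset.cover (components G) by rewrite covG.
by case/bigcupP=> B; rewrite -C_comp => /imsetP[i _ ->] xi; exists i.
Qed.

Lemma comp_uniq x i j : x \in C i -> x \in C j -> i = j.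
Proof.
have /and3P[_ /trivIsetP triv _] := components_part.
move=> xi xj; apply: C_inj; apply/eqP; apply: contraT => ij.
have mC l : C l \in components G by rewrite -C_comp imset_f.
have := triv _ _ (mC i) (mC j) ij; rewrite -setI_eq0 => /eqP/setP/(_ x).
by rewrite !inE xi xj.
Qed.

Lemma comp_adj x y i : adj x y -> x \in C i -> y \in C i.
Proof.
move=> xy xi; have : C i \in components G by rewrite -C_comp imset_f.
case/imsetP=> z _ Cz; move: xi; rewrite Cz !inE => /connect_trans; apply.
exact: connect1.
Qed.

Definition part_set i (X : {set G}) : {set Gi i} := [set y | sval y \in X].

Lemma part_set_cover i (X : cover G) : part_set i (val X) \in vertex_covers (Gi i).
Proof.
rewrite inE; apply/forallP=> x; apply/forallP=> y; apply/implyP=> xy.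
by rewrite !inE; exact: (cover_adj X (xy : adj (val x) (val y))).
Qed.

Definition part_cover i (X : cover G) : cover (Gi i) :=
  Sub (part_set i (val X)) (part_set_cover i X).

Definition glue_set (Y : forall i, cover (Gi i)) : {set G} :=
  \bigcup_i [set sval y | y in val (Y i)].

Lemma mem_glue_set Y i (y : Gi i) : (sval y \in glue_set Y) = (y \in val (Y i)).
Proof.
apply/bigcupP/idP => [[j _ /imsetP[z zY yz]]|yY]; last first.
  by exists i => //; apply: imset_f.
have ji : j = i by apply: (@comp_uniq (sval z)); rewrite ?(valP z) // -yz (valP y).
by subst j; rewrite (val_inj yz).
Qed.

(** Each edge lies inside one component and is covered there. *)
Lemma glue_set_cover Y : glue_set Y \in vertex_covers G.
Proof.
rewrite inE; apply/forallP=> x; apply/forallP=> y; apply/implyP=> xy.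
have [i xi] := comp_cover x; have yi := comp_adj xy xi.
rewrite -[x]/(sval (exist _ x xi : Gi i)) -[y]/(sval (exist _ y yi : Gi i)).
by rewrite !mem_glue_set; apply: cover_adj.
Qed.

Definition glue Y : cover G := Sub (glue_set Y) (glue_set_cover Y).

Lemma mem_part_cover i (X : cover G) (y : Gi i) :
  (y \in val (part_cover i X)) = (sval y \in val X).
Proof. by rewrite inE. Qed.

Lemma part_glue i Y : part_cover i (glue Y) = Y i.
Proof.
by apply/val_inj/setP=> y; rewrite mem_part_cover mem_glue_set.
Qed.

Lemma part_inj X Y : (forall i, part_cover i X = part_cover i Y) -> X = Y.
Proof.
move=> XY; apply/val_inj/setP=> x; have [i xi] := comp_cover x.
have := XY i => /(congr1 val)/setP/(_ (exist _ x xi)).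
by rewrite !mem_part_cover.
Qed.

Lemma part_toggle i (y : Gi i) X :
  part_cover i (toggle (sval y) X) = toggle y (part_cover i X).
Proof.
apply/val_inj/setP=> z; rewrite mem_part_cover.
have [->|zy] := eqVneq z y; last by rewrite !toggle_out ?mem_part_cover.
rewrite !toggle_in mem_part_cover; congr (_ || _).
apply/existsP/existsP => [[b /andP[yb bX]]|[b /andP[yb bX]]].
  have bi := comp_adj yb (valP y).
  by exists (exist _ b bi); rewrite mem_part_cover bX andbT.
by exists (sval b); rewrite -mem_part_cover bX andbT.
Qed.

Lemma part_toggle_out i a X : a \notin C i ->
  part_cover i (toggle a X) = part_cover i X.
Proof.
move=> ai; apply/val_inj/setP=> z; rewrite !mem_part_cover toggle_out //.
by apply: contraNneq ai => <-; exact: valP z.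
Qed.

Local Notation prodperm := {dffun forall i, {perm cover (Gi i)}}.

(** The coordinatewise action, transported along the bijection between covers of [G] and families of
    covers of the components. *)
Definition glue_act (p : prodperm) X := glue (fun i => p i (part_cover i X)).

Lemma part_glue_act p X i : part_cover i (glue_act p X) = p i (part_cover i X).
Proof. exact: part_glue. Qed.

Lemma glue_act_inj p : injective (glue_act p).
Proof.
move=> X Y XY; apply: part_inj => i; apply: (@perm_inj _ (p i)).
by rewrite -!part_glue_act XY.
Qed.

Definition glue_perm p : {perm cover G} := perm (@glue_act_inj p).

Lemma part_glue_perm p X i : part_cover i (glue_perm p X) = p i (part_cover i X).
Proof. by rewrite permE part_glue_act. Qed.

Lemma glue_permM : {morph glue_perm : p q / p * q}.
Proof.
move=> p q; apply/permP=> X; apply: part_inj => i.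
by rewrite permM !part_glue_perm mulg_ffun permM.
Qed.

Canonical glue_perm_morphism := @Morphism _ _ setT _ (in2W glue_permM).

Lemma injm_glue_perm : 'injm glue_perm.
Proof.
apply/subsetP=> p /morphpreP[_ /set1P p1]; apply/set1P/ffunP=> i.
apply/permP=> Y; rewrite oneg_ffun perm1.
(* To test [p i] at [Y], extend [Y] to a cover of [G] by the full cover on every other component. *)
pose Z : forall j, cover (Gi j) := dfwith (fun j => coverT (Gi j)) Y.
have := part_glue_perm p (glue Z) i; rewrite p1 perm1 part_glue.
by rewrite /Z dfwith_in.
Qed.

Lemma glue_perm_toggle i (y : Gi i) :
  glue_perm (dfung1 (toggle_perm (vertex_covers (Gi i)) y)) =
  toggle_perm (vertex_covers G) (sval y).
Proof.
apply/permP=> X; rewrite toggle_permE; apply: part_inj => j.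
rewrite part_glue_perm; have [<-|ij] := eqVneq i j.
  by rewrite dfung1_id toggle_permE part_toggle.
rewrite dfung1_dflt // perm1 part_toggle_out //.
by apply: contraNN ij => yj; apply/eqP; apply: comp_uniq yj; exact: valP y.
Qed.

Lemma components_toggle_group :
  toggle_group (vertex_covers G)
    \isog setXn (fun i => toggle_group (vertex_covers (Gi i))).
Proof.
rewrite isog_sym.
pose H i := toggle_group (vertex_covers (Gi i)).
(* [glue_perm] is injective on the product of the full symmetric groups, so it embeds the product of
   the toggle groups; only its image has to be identified, by comparing generators. *)
suff <- : glue_perm @* setXn (fun i => H i) = toggle_group (vertex_covers G).
  exact: (sub_isog (subsetT _) injm_glue_perm).
apply/eqP; rewrite eqEsubset; apply/andP; split.
  rewrite sub_morphim_pre ?subsetT // -setXn_prod prod_subG // => i _.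
  rewrite -morphim_dfung1 morphim_gen ?subsetT // gen_subG.
  apply/subsetP=> _ /morphimP[_ _ /imsetP[y _ ->] ->].
  rewrite inE in_setT /= inE glue_perm_toggle.
  exact/mem_gen/imset_f.
rewrite gen_subG; apply/subsetP=> _ /imsetP[a _ ->].
have [i ai] := comp_cover a; rewrite -[a]/(sval (exist _ a ai : Gi i)).
rewrite -glue_perm_toggle; apply: mem_morphim; first exact: in_setT.
apply/setXnP=> j; have [<-|ij] := eqVneq i j.
  by rewrite dfung1_id; apply/mem_gen/imset_f.
by rewrite dfung1_dflt.
Qed.
End Components.

Theorem corollary3p27 (G : sgraph) :
  (connected G ->
     toggle_group (vertex_covers G)
       = 'Sym_{X : {set G} | X \in vertex_covers G} :> {set _} \/
     toggle_group (vertex_covers G)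
       = 'Alt_{X : {set G} | X \in vertex_covers G} :> {set _})
  /\
  (forall (k : nat) (C : 'I_k -> {set G}),
     injective C ->
     [set C i | i : 'I_k] = components G ->
     toggle_group (vertex_covers G)
       \isog setXn (fun i : 'I_k =>
               toggle_group (vertex_covers (induced (C i))))).
Proof.
split=> [conG|k C C_inj C_comp]; last exact: components_toggle_group.
exact/Alt_sub_eq/connected_toggle_group.
Qed.
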